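(* Let $G$ be a finite almost-median graph and $k\geqslant 0$ an integer. Then $G$ is $k$-regular if and only if $G\cong Q_k$.
   Context: All graphs are finite, simple and undirected. A subgraph $H$ of $G$ is isometric if $d_H(u,v)=d_G(u,v)$ for all $u,v\in V(H)$. A partial cube is a connected graph isomorphic to an isometric subgraph of some hypercube $Q_n$. In a partial cube, the Djoković–Winkler relation $\Theta$ on edges is: for edges $e=uv$, $f=xy$, $e\,\Theta\,f$ iff $d(u,x)+d(v,y)\neq d(u,y)+d(v,x)$; it is an equivalence relation, and $F_{uv}$ denotes the $\Theta$-class of $uv$. Let $W_{uv}=\{w\in V(G): d(u,w)<d(v,w)\}$ and $U_{uv}=\{w\in W_{uv}: w \text{ is incident with an edge of } F_{uv}\}$. A partial cube $G$ is an almost-median graph if for every edge $uv$ the subgraphs induced by $U_{uv}$ and by $U_{vu}$ are isometric subgraphs of $G$. $Q_k$ is the $k$-dimensional hypercube ($Q_0=K_1$). *)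

(* Defs.v *)
From mathcomp Require Import all_boot.
Set Implicit Arguments. Unset Strict Implicit. Unset Printing Implicit Defensive.

Definition simple_graph (T : finType) (e : rel T) : Prop :=
  symmetric e /\ irreflexive e.

Fixpoint reach (T : finType) (V : {set T}) (e : rel T) (x : T) (n : nat)
  : {set T} :=
  match n with
  | 0 => V :&: [set x]
  | n'.+1 => let R := reach V e x n' in
             R :|: [set y in V | [exists z in R, e z y]]
  end.

(* Distance in the graph (V, e restricted to V); if y is unreachable from x
   the value is #|T| (an "infinity" exceeding every finite distance). *)
Definition dist (T : finType) (V : {set T}) (e : rel T) (x y : T) : nat :=
  find (fun n => y \in reach V e x n) (iota 0 #|T|).

Definition gdist (T : finType) (e : rel T) (x y : T) : nat := dist setT e x y.

Definition isometric_subgraph (T : finType) (e : rel T)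
    (S : {set T}) (eH : rel T) : Prop :=
  (forall a b, eH a b -> [/\ a \in S, b \in S & e a b]) /\
  (forall a b, a \in S -> b \in S -> dist S eH a b = gdist e a b).

Definition cube (n : nat) := {ffun 'I_n -> bool}.
Definition cube_edge (n : nat) : rel (cube n) :=
  fun a b => #|[set i | a i != b i]| == 1.

Definition connected (T : finType) (e : rel T) : Prop :=
  (exists x : T, True) /\ (forall x y : T, connect e x y).

Definition partial_cube (T : finType) (e : rel T) : Prop :=
  connected e /\
  exists (n : nat) (S : {set cube n}) (eH : rel (cube n)),
    isometric_subgraph (@cube_edge n) S eH /\
    exists f : T -> cube n,
      [/\ injective f, f @: setT = S &
          forall x y, e x y = eH (f x) (f y)].

Definition theta (T : finType) (e : rel T) (u v x y : T) : bool :=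
  gdist e u x + gdist e v y != gdist e u y + gdist e v x.

Definition Wset (T : finType) (e : rel T) (u v : T) : {set T} :=
  [set w | gdist e u w < gdist e v w].

Definition Uset (T : finType) (e : rel T) (u v : T) : {set T} :=
  [set w in Wset e u v | [exists x, e w x && theta e u v w x]].

Definition isometric_induced (T : finType) (e : rel T) (S : {set T}) : Prop :=
  forall a b, a \in S -> b \in S -> dist S e a b = gdist e a b.

Definition almost_median (T : finType) (e : rel T) : Prop :=
  partial_cube e /\
  forall u v, e u v ->
    isometric_induced e (Uset e u v) /\ isometric_induced e (Uset e v u).

Definition regular (T : finType) (e : rel T) (k : nat) : Prop :=
  forall v : T, #|[set w | e v w]| = k.

Definition iso_to_cube (T : finType) (e : rel T) (k : nat) : Prop :=
  exists f : T -> cube k,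
    bijective f /\ forall x y, e x y = cube_edge (f x) (f y).

(* Main.v *)
(* Embed G isometrically in a cube with vertex set V and let A(x) be the set of
   directions i with x + i in V.  For b in A(x) put N = A(x) :&: A(x + b).
   Isometry of the sets U shows that, among the vertices of V agreeing with x on
   N \ b, the edge from x to x + b is a bridge, and hence that every vertex
   beyond it agrees with x on all of A(x) \ b.  If A(x) is not contained in
   A(x + b), regularity provides c in A(x + b) \ A(x), and then b is not in
   A(x + b + c), while the part of V beyond the edge from x + b to x + b + c
   lies strictly inside the part beyond the edge from x to x + b: an infinite
   descent.  So A is constant and V is a subcube. *)
Require Import Defs.
From mathcomp Require Import all_boot.
From mathcomp Require Import zify.
Set Implicit Arguments. Unset Strict Implicit. Unset Printing Implicit Defensive.

(** * Walks and graph distance *)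

Section Reach.
Variables (T : finType) (V : {set T}) (e : rel T).

Lemma distP x y : dist V e x y < #|T| -> y \in reach V e x (dist V e x y).
Proof.
move=> ltd; have ltd' : dist V e x y < size (iota 0 #|T|) by rewrite size_iota.
have := ltd'; rewrite -has_find => /(nth_find 0).
by rewrite nth_iota.
Qed.

Lemma dist_eq x y d : d < #|T| -> y \in reach V e x d ->
  (forall m, y \in reach V e x m -> d <= m) -> dist V e x y = d.
Proof.
move=> ltd yd mind; apply/eqP; rewrite eqn_leq; apply/andP; split.
  rewrite leqNgt; apply/negP => /(before_find 0).
  by rewrite nth_iota // add0n yd.
apply: mind; apply: distP; rewrite /dist -[X in _ < X](size_iota 0).
by rewrite -has_find; apply/hasP; exists d; rewrite ?mem_iota.
Qed.

Lemma reach_leq (h : T -> T -> nat) x y n :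
  (forall x, h x x = 0) -> (forall x y z, e y z -> h x z <= (h x y).+1) ->
  y \in reach V e x n -> h x y <= n.
Proof.
move=> h0 hS; elim: n y => [|n IHn] y /=.
  by rewrite !inE => /andP[_ /eqP->]; rewrite h0.
rewrite !inE => /orP[/IHn/leqW//|/andP[_ /existsP[z /andP[/IHn zn ezy]]]].
by apply: leq_trans (hS _ _ _ ezy) _.
Qed.

(** Descending from [y] until [x] is met and reversing gives a walk of at most [h x y] steps; reach
    sets grow with the step count, so a shorter walk suffices. *)
Lemma reach_descent (h : T -> T -> nat) x y :
  x \in V -> (forall y, h x y = 0 -> x = y) ->
  (forall y, y \in V -> x != y ->
     exists2 z, z \in V & e z y /\ h x z < h x y) ->
  y \in V -> y \in reach V e x (h x y).
Proof.
move=> xV h0 step; have [n] := ubnP (h x y).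
elim: n y => // n IHn y; rewrite ltnS => hn yV.
have [<-|neq] := eqVneq x y.
  by elim: (h x x) => [|m IHm] /=; rewrite !inE ?xV ?eqxx // IHm.
have [z zV [ezy lt]] := step y yV neq.
have zr := IHn z (leq_trans lt hn) zV.
case E : (h x y) => [|m]; first by rewrite E in lt.
rewrite /= inE; apply/orP; right; rewrite inE yV; apply/existsP; exists z.
rewrite ezy andbT; have lem : h x z <= m by rewrite -ltnS -E.
by rewrite -(subnKC lem); elim: (m - _) => [|p IHp];
   rewrite ?addn0 // addnS /= inE IHp.
Qed.

(** The last step of a shortest walk raises [h]; this turns isometry into a local condition. *)
Lemma dist_last (h : T -> T -> nat) x y :
  (forall x, h x x = 0) -> (forall x y z, e y z -> h x z <= (h x y).+1) ->
  x != y -> dist V e x y = h x y -> h x y < #|T| ->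
  exists2 z, z \in V & e z y /\ h x z < h x y.
Proof.
move=> h0 hS neq dh lt.
have := @distP x y; rewrite dh => /(_ lt).
case E : (h x y) => [|m] /=.
  by rewrite !inE eq_sym (negPf neq) andbF.
have step z : z \in reach V e x m -> z \in V /\ h x z < m.+1.
  move=> zm; split; last by rewrite ltnS; apply: (reach_leq h0 hS).
  elim: m zm {E} => [|m IHm] /=; first by rewrite !inE => /andP[].
  by rewrite !inE => /orP[|/andP[]].
rewrite inE => /orP[ym|]; first by have [_] := step y ym; rewrite E ltnn.
rewrite inE => /andP[yV /existsP[z /andP[zm ezy]]].
by have [zV zh] := step z zm; exists z.
Qed.

End Reach.

(** * Hamming distance and geodetic vertex sets of a cube *)

Section Hamming.
Variable n : nat.
Implicit Types (x y z : cube n) (i j : 'I_n) (V : {set cube n}).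

Definition ham x y := #|[set i | x i != y i]|.
Definition flip i x : cube n := [ffun j => if j == i then ~~ x j else x j].

Lemma flipE i x j : flip i x j = if j == i then ~~ x j else x j.
Proof. by rewrite ffunE. Qed.

Lemma flipK i : involutive (flip i).
Proof. by move=> x; apply/ffunP=> j; rewrite !flipE; case: eqP; rewrite ?negbK. Qed.

Lemma flipC i j x : flip i (flip j x) = flip j (flip i x).
Proof.
by apply/ffunP=> l; rewrite !flipE; case: (l == i); case: (l == j); rewrite ?negbK.
Qed.

Lemma flip_injl x : injective (flip^~ x).
Proof.
move=> i j /ffunP/(_ i); rewrite !flipE eqxx.
by case: eqP => // _; case: (x i).
Qed.

Lemma ham_sum x y : ham x y = \sum_i (x i != y i).
Proof.
by rewrite /ham -sum1_card [LHS]big_mkcond; apply: eq_bigr => i _; rewrite inE; case: ifP.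
Qed.

Lemma hamxx x : ham x x = 0.
Proof. by rewrite ham_sum big1 // => i _; rewrite eqxx. Qed.

Lemma ham_sym x y : ham x y = ham y x.
Proof. by rewrite !ham_sum; apply: eq_bigr => i _; rewrite eq_sym. Qed.

Lemma ham_eq0 x y : ham x y = 0 -> x = y.
Proof.
move=> /eqP; rewrite cards_eq0 => /eqP/setP xy; apply/ffunP => i.
by have := xy i; rewrite !inE => /negbFE/eqP.
Qed.

(** The additive form covers gain and loss at once without truncated subtraction. *)
Lemma ham_flip x y i : ham x (flip i y) + (x i != y i) = ham x y + (x i == y i).
Proof.
rewrite !ham_sum (bigD1 i) //= [X in _ = X + _](bigD1 i) //= flipE eqxx.
rewrite (eq_bigr (fun j => (x j != y j) : nat)) => [|j /negPf ji].
  by case: (x i); case: (y i) => /=; lia.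
by rewrite flipE ji.
Qed.

Lemma cube_edgeP x y : reflect (exists i, y = flip i x) (cube_edge x y).
Proof.
apply: (iffP cards1P) => [[i /setP xy]|[i ->]]; exists i.
  apply/ffunP=> j; rewrite flipE; have := xy j; rewrite !inE.
  by case: (j == i); case: (x j); case: (y j).
by apply/setP=> j; rewrite !inE flipE; case: (j == i); case: (x j).
Qed.

Lemma ham_edge x y z : cube_edge y z -> ham x z <= (ham x y).+1.
Proof. by move=> /cube_edgeP[i ->]; have := ham_flip x y i; lia. Qed.

Lemma ham_lt_card x y : ham x y < #|{: cube n}|.
Proof.
rewrite card_ffun card_bool card_ord.
by apply: leq_ltn_trans (ltn_expl n (ltnSn 1)); rewrite -[X in _ <= X]card_ord max_card.
Qed.

Lemma ham_descent x y : x != y ->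
  exists i, x i != y i /\ ham x (flip i y) < ham x y.
Proof.
move=> neq; have [i xyi|xy] := pickP (fun i => x i != y i).
  by exists i; split=> //; have := ham_flip x y i; rewrite (negPf xyi) /=; lia.
by case/eqP: neq; apply/ffunP => i; have /negbFE/eqP := xy i.
Qed.

Lemma gdist_cube x y : gdist (@cube_edge n) x y = ham x y.
Proof.
apply: dist_eq; first exact: ham_lt_card.
  apply: reach_descent => //; first exact: ham_eq0.
  move=> {}y _ /ham_descent[i [_ lt]]; exists (flip i y); rewrite ?inE //.
  by split=> //; apply/cube_edgeP; exists i; rewrite flipK.
by move=> m; apply: (reach_leq hamxx (@ham_edge)).
Qed.

(** A local form of isometry: iterating the step joins [x] to [y] inside [V] by a path of length
    [ham x y]. *)
Definition geodetic V := forall x y, x \in V -> y \in V -> x != y ->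
  exists2 i, x i != y i & flip i x \in V.

(* For an edge u v in direction i, the set U_uv is the zone with c = u i. *)
Definition zone V i c := [set x in V | (flip i x \in V) && (x i == c)].

Definition dirs V x := [set i | flip i x \in V].

(** Walk from [x] towards [y] up to the edge in direction [j]; a geodesic never flips a coordinate
    on which its ends agree. *)
Lemma geodetic_cross V x y j : geodetic V -> x \in V -> y \in V -> x j != y j ->
  exists z, [/\ z \in V, flip j z \in V, z j = x j &
                forall l, x l = y l -> z l = x l].
Proof.
move=> gV; have [m] := ubnP (ham y x).
elim: m x => // m IHm x; rewrite ltnS => hm xV yV xyj.
have neq : x != y by apply: contraNneq xyj => ->.
have [i xyi ixV] := gV x y xV yV neq.
have [ij|ij] := eqVneq i j; first by exists x; split; rewrite -?ij.
have ltm : ham y (flip i x) < m.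
  by have := ham_flip y x i; rewrite eq_sym (negPf xyi) /=; lia.
have jx : flip i x j = x j by rewrite flipE eq_sym (negPf ij).
have [|z [zV jzV zj zl]] := IHm _ ltm ixV yV; first by rewrite jx.
exists z; split=> //; first by rewrite zj.
move=> l xyl; have il : (l == i) = false.
  by apply: contraNF xyi => /eqP<-; rewrite xyl.
by rewrite zl flipE il.
Qed.

(** * Regular vertex sets with geodetic zones are subcubes *)

Section Regular.
Variables (V : {set cube n}) (k : nat).
Hypotheses (gV : geodetic V) (gZ : forall i c, geodetic (zone V i c)).
Hypothesis regV : {in V, forall x, #|dirs V x| = k}.

(** A disagreement at [j] is crossed between [flip b x] and [y], at some [z]. Inside the zone of
    [j], the way from [x] to [z] crosses [b] at some [w]. Either [w = x] and [j] is a common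
    direction of [x] and [flip b x], or the first step from [x] to [w] is one; both contradict
    [agree]. *)
Lemma far_side x b y : x \in V -> y \in V -> flip b x \in V -> x b != y b ->
  {in dirs V x :&: dirs V (flip b x), forall j, j != b -> x j = y j} ->
  {in dirs V x, forall j, j != b -> x j = y j}.
Proof.
move=> xV yV bxV xyb agree j; rewrite inE => jxV jb.
apply: contraTeq (isT) => xyj /=.
have [|z [zV jzV zj zl]] := @geodetic_cross V (flip b x) y j gV bxV yV.
  by rewrite flipE (negPf jb).
rewrite flipE (negPf jb) in zj.
have zb : z b != x b.
  by rewrite zl flipE eqxx; case: (x b) (y b) xyb => [] [].
(* A geodesic from x to z inside U_j crosses direction b. *)
have [|||w [wZ bwZ wb wl]] := @geodetic_cross (zone V j (x j)) x z b (@gZ _ _).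
- by rewrite inE xV jxV eqxx.
- by rewrite inE zV jzV zj eqxx.
- by rewrite eq_sym.
move: wZ bwZ; rewrite !inE => /and3P[wV jwV _] /and3P[bwV bjwV _].
have [xw|xw] := eqVneq x w.
  have /agree-/(_ jb) : j \in dirs V x :&: dirs V (flip b x).
    by rewrite !inE jxV xw.
  by move/eqP; rewrite (negPf xyj).
(* A first step from x towards w inside U_b is a direction in N leading out. *)
have [||//|i xwi] := @gZ b (x b) x w; rewrite ?inE ?xV ?bxV ?eqxx //.
  by rewrite wV bwV wb eqxx.
case/and3P=> ixV bixV _.
have ib : i != b by apply: contraNneq xwi => ->; rewrite wb.
have xyi : x i = y i by apply: agree; rewrite // !inE ixV flipC.
case/eqP: xwi; rewrite wl // zl flipE (negPf ib) //.
Qed.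

(** The size of this set is the measure of the descent. When [x] and [flip b x] lie in [V],
    [far_side] shows that agreement on their common directions would define the same set. *)
Definition beyond x b :=
  [set y in V | (x b != y b) && [forall j in dirs V x, (j != b) ==> (x j == y j)]].

Lemma dirs_flip_sub x b : x \in V -> flip b x \in V ->
  dirs V x \subset dirs V (flip b x).
Proof.
have [m] := ubnP #|beyond x b|; elim: m x b => // m IHm x b.
rewrite ltnS => hm xV bxV; apply/negPn/negP => nsub.
(* Both direction sets have size [k], so either inclusion would force equality. *)
have : ~~ (dirs V (flip b x) \subset dirs V x).
  apply: contra nsub => sub; have/subset_leqif_cards[_] := sub.
  by rewrite !regV // eqxx => /esym/eqP->.
case/subsetPn=> c cb' cx; have cbV : flip c (flip b x) \in V by rewrite inE in cb'.
have cNb : c != b by apply: contraNneq cx => ->; rewrite inE.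
have bsub : beyond (flip b x) c \proper beyond x b.
  apply/properP; split; last first.
    (* Strictness: [flip b x] does not differ from itself at [c]. *)
    exists (flip b x); rewrite !inE ?eqxx ?andbF // bxV flipE eqxx /=.
    apply/andP; split; first by case: (x b).
    by apply/forall_inP=> j _; apply/implyP=> /negPf jb; rewrite flipE jb.
  apply/subsetP=> y; rewrite [y \in beyond _ c]inE => /and3P[yV _ /forall_inP ag].
  have xyb : x b != y b.
    have bdir : b \in dirs V (flip b x) by rewrite inE flipK.
    have /implyP := ag b bdir; rewrite eq_sym cNb flipE eqxx => /(_ isT)/eqP <-.
    by case: (x b).
  rewrite inE yV xyb; apply/forall_inP=> j jx; apply/implyP=> jb; apply/eqP.
  apply: (far_side xV yV bxV xyb) jx jb => l /setIP[lx lbx] lb.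
  have lc : l != c by apply: contraNneq cx => <-.
  by have /implyP/(_ lc)/eqP := ag l lbx; rewrite flipE (negPf lb).
(* The direction [b] leads from [flip b x] back to [x]; by induction it survives the flip of [c],
   which puts [flip c x] in [V], against the choice of [c]. *)
have /subsetP/(_ b) := IHm _ c (leq_trans (proper_card bsub) hm) bxV cbV.
by rewrite inE flipK xV => /(_ isT); rewrite inE flipC flipK; move: cx; rewrite inE => /negP.
Qed.

Lemma dirs_flip x b : x \in V -> flip b x \in V -> dirs V (flip b x) = dirs V x.
Proof.
move=> xV bxV; apply/eqP; rewrite eqEsubset dirs_flip_sub // andbT.
by rewrite -[X in _ \subset dirs V X](flipK b) dirs_flip_sub ?flipK.
Qed.

Lemma dirs_const x y : x \in V -> y \in V -> dirs V x = dirs V y.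
Proof.
have [m] := ubnP (ham y x); elim: m x => // m IHm x; rewrite ltnS => hm xV yV.
have [->//|neq] := eqVneq x y.
have [i xyi ixV] := gV xV yV neq; rewrite -(dirs_flip xV ixV); apply: IHm => //.
by have := ham_flip y x i; rewrite eq_sym (negPf xyi) /=; lia.
Qed.

(** Flip the disagreeing coordinates one by one; each flip stays in [V] and leaves the direction set
    unchanged. *)
Lemma mem_subcube x y : x \in V -> (forall i, x i != y i -> i \in dirs V x) -> y \in V.
Proof.
have [m] := ubnP (ham y x); elim: m x => // m IHm x; rewrite ltnS => hm xV sub.
have [i xyi|xy] := pickP (fun i => x i != y i); last first.
  suff -> : y = x by [].
  by apply/ffunP => i; have /negbFE/eqP := xy i.
have ixV : flip i x \in V by have := sub i xyi; rewrite inE.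
apply: (IHm (flip i x)) => //.
  by have := ham_flip y x i; rewrite eq_sym (negPf xyi) /=; lia.
move=> j; rewrite flipE dirs_flip //; case: (j =P i) => [-> _|_]; exact: sub.
Qed.

Lemma subcube_diff x y i : x \in V -> y \in V -> x i != y i -> i \in dirs V x.
Proof.
move=> xV yV xyi; have [z [zV izV _ _]] := geodetic_cross gV xV yV xyi.
by rewrite (dirs_const xV zV) inE.
Qed.

End Regular.
End Hamming.

(** * Graphs embedded isometrically in a cube *)

Section Embedding.
Variables (T : finType) (e : rel T) (n : nat) (f : T -> cube n).
Hypotheses (f_inj : injective f).
Hypothesis f_edge : forall x y, e x y = cube_edge (f x) (f y).
Let V := f @: setT.

Lemma emb_mem x : f x \in V.
Proof. by rewrite imset_f ?inE. Qed.

Lemma emb_flip x y : e x y -> exists i, f y = flip i (f x).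
Proof. by rewrite f_edge => /cube_edgeP. Qed.

Lemma flip_edge x y i : f y = flip i (f x) -> e x y.
Proof. by move=> fy; rewrite f_edge; apply/cube_edgeP; exists i. Qed.

Lemma card_dirs x : #|[set y | e x y]| = #|dirs V (f x)|.
Proof.
rewrite -(card_imset _ f_inj) -(card_imset _ (@flip_injl _ (f x))).
apply: eq_card => p; apply/imsetP/imsetP => [[y]|[i]].
  by rewrite inE => /emb_flip[i fy] ->; exists i; rewrite // inE -fy emb_mem.
rewrite inE => /imsetP[y _ fy] ->; exists y; rewrite ?fy // inE.
exact: flip_edge (esym fy).
Qed.

Lemma flip_closer x y z : e z y -> ham (f x) (f z) < ham (f x) (f y) ->
  exists2 i, f y i != f x i & f z = flip i (f y).
Proof.
rewrite f_edge => /cube_edgeP[i fy] lt; exists i; last by rewrite fy flipK.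
have fz : f z = flip i (f y) by rewrite fy flipK.
apply: contraTN lt => /eqP xyi; rewrite fz -leqNgt.
by have := ham_flip (f x) (f y) i; rewrite xyi eqxx /=; lia.
Qed.

Hypothesis step : forall x y, x != y ->
  exists2 z, e z y & ham (f x) (f z) < ham (f x) (f y).

Lemma emb_geodetic : geodetic V.
Proof.
move=> _ _ /imsetP[x _ ->] /imsetP[y _ ->] neq.
have [|z ezx lt] := @step y x; first by apply: contraNneq neq => ->.
have [i xyi fz] := flip_closer ezx lt.
by exists i; rewrite // -fz emb_mem.
Qed.

Lemma emb_ham_edge x y z : e y z -> ham (f x) (f z) <= (ham (f x) (f y)).+1.
Proof. by rewrite f_edge; apply: ham_edge. Qed.

(** Descending from [y] to [x] meets every smaller Hamming distance, so there are more vertices than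
    the distance. This keeps it in the range that [dist] searches. *)
Lemma emb_ham_lt_card x y : ham (f x) (f y) < #|T|.
Proof.
have dist_onto m : m <= ham (f x) (f y) -> exists z, ham (f x) (f z) = m.
  have [b] := ubnP (ham (f x) (f y)); elim: b y => // b IHb y.
  rewrite ltnS => hb; rewrite leq_eqVlt => /orP[/eqP->|lt]; first by exists y.
  have neq : x != y by apply: contraTneq lt => ->; rewrite hamxx.
  have [z ezy ltz] := step neq; apply: (IHb z); first exact: leq_trans hb.
  by have := emb_ham_edge x ezy; lia.
rewrite -(size_codom (fun z => ham (f x) (f z))) -[X in X < _](size_iota 0).
rewrite -[X in X <= _](size_iota 0) uniq_leq_size ?iota_uniq // => m.
rewrite mem_iota size_iota ltnS => /dist_onto[z <-]; exact: codom_f.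
Qed.

Lemma gdist_emb x y : gdist e x y = ham (f x) (f y).
Proof.
apply: dist_eq; first exact: emb_ham_lt_card.
  apply: (reach_descent (h := fun x y => ham (f x) (f y))); rewrite ?inE //.
    by move=> z /ham_eq0/f_inj.
  by move=> z _ /step[w ewz lt]; exists w; rewrite ?inE.
move=> m; apply: (reach_leq (h := fun x y => ham (f x) (f y))) => [z|z a b].
  exact: hamxx.
exact: emb_ham_edge.
Qed.

(** The Θ-class of an edge in direction [i] is the set of all edges in direction [i]: flipping [j]
    changes the distances to [u] and [v] alike exactly when [j != i]. *)
Lemma mem_Uset u v i w : f v = flip i (f u) ->
  (w \in Uset e u v) = (f w \in zone V i (f u i)).
Proof.
move=> fv; have vw x : ham (f v) x + (x i != f u i) = ham (f u) x + (x i == f u i).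
  by have := ham_flip x (f u) i; rewrite -fv ![ham x _]ham_sym.
rewrite !inE !gdist_emb emb_mem /=.
have -> : (ham (f u) (f w) < ham (f v) (f w)) = (f w i == f u i).
  by have := vw (f w); case: eqP => /= _; lia.
rewrite andbC; congr (_ && _).
have th x j : f x = flip j (f w) -> theta e u v w x = (j == i).
  move=> fx; rewrite /theta !gdist_emb fx.
  have := ham_flip (f u) (f w) j; have := ham_flip (f v) (f w) j.
  rewrite fv [flip i _ j]flipE; case: (j == i); last first.
    by case: (f u j == f w j) => /=; lia.
  by case: (f u j); case: (f w j) => /=; lia.
apply/existsP/imsetP => [[x /andP[/emb_flip[j fx]]]|[x _ fx]].
  by rewrite (th _ _ fx) => /eqP<-; exists x.
by exists x; rewrite (th _ _ (esym fx)) eqxx andbT (flip_edge (esym fx)).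
Qed.

Lemma emb_zone_geodetic i c :
  (forall u v, e u v -> isometric_induced e (Uset e u v)) ->
  geodetic (zone V i c).
Proof.
move=> iso p q; rewrite [in X in X -> _]inE.
case/and3P=> /imsetP[x _ ->] /imsetP[x' _ fx'] /eqP<-{c}.
move=> qZ; have: q \in V by move: qZ; rewrite inE => /and3P[].
case/imsetP=> y _ qy; rewrite {}qy in qZ *; move=> neq.
have exx' := flip_edge (esym fx').
have xU : x \in Uset e x x'.
  by rewrite (mem_Uset _ (esym fx')) inE emb_mem fx' emb_mem eqxx.
have yU : y \in Uset e x x' by rewrite (mem_Uset _ (esym fx')).
(* Distances run from [y] to [x], since the last step into [x], reversed, is the first step from [x]
   towards [y]. *)
have := iso _ _ exx' y x yU xU; rewrite gdist_emb => dyx.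
have [|||z zU [ezx lt]] :=
    dist_last (h := fun x y => ham (f x) (f y)) _ _ _ dyx (emb_ham_lt_card y x).
- by move=> ?; apply: hamxx.
- by move=> ? ? ?; apply: emb_ham_edge.
- by apply: contraNneq neq => ->.
have [j xyj fz] := flip_closer ezx lt; exists j => //.
by rewrite -fz -(mem_Uset _ (esym fx')).
Qed.

Lemma regular_iso_to_cube k (x0 : T) :
  (forall i c, geodetic (zone V i c)) -> regular e k -> iso_to_cube e k.
Proof.
move=> gZ reg; have regV : {in V, forall p, #|dirs V p| = k}.
  by move=> _ /imsetP[x _ ->]; rewrite -card_dirs.
have gV := emb_geodetic.
pose A := dirs V (f x0); have kA : #|A| = k by apply: regV; exact: emb_mem.
rewrite -{}kA in reg regV *.
(* Only the coordinates in [A] are kept: all vertices agree on the others. *)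
pose g x : cube #|A| := [ffun j => f x (enum_val j)].
have ham_g x y : ham (g x) (g y) = ham (f x) (f y).
  rewrite [RHS]ham_sum (bigID (mem A)) /= [X in _ + X]big1 ?addn0 => [|i iA].
    by rewrite big_enum_val ham_sum; apply: eq_bigr => j _; rewrite !ffunE.
  have [//|xyi] := eqVneq (f x i) (f y i); case/negP: iA; change (i \in A).
  rewrite /A (dirs_const gV gZ regV (emb_mem x0) (emb_mem x)).
  by apply: (subcube_diff gV gZ regV (emb_mem x) (emb_mem y)).
have g_inj : injective g.
  by move=> x y gxy; apply/f_inj/ham_eq0; rewrite -ham_g gxy hamxx.
exists g; split=> [|x y]; last first.
  by rewrite f_edge /cube_edge -![#|_|]/(ham _ _) ham_g.
apply: inj_card_bij => //; rewrite -cardsT -[X in _ <= X]cardsT.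
apply: leq_trans (leq_imset_card g _); apply/subset_leq_card/subsetP => c _.
(* A preimage of [c]: write [c] into the coordinates of [A] and copy [f x0] elsewhere, so that
   [mem_subcube] applies. *)
pose p : cube n :=
  [ffun i => if [pick j | enum_val j == i] is Some j then c j else f x0 i].
have : p \in V.
  apply: (mem_subcube gV gZ regV (emb_mem x0)) => i; rewrite ffunE.
  by case: pickP => [j /eqP<- _|_ /eqP//]; exact: enum_valP.
case/imsetP=> x _ px; apply/imsetP; exists x; rewrite ?inE //.
apply/ffunP=> j; rewrite ffunE -px ffunE.
by case: pickP => [l /eqP/enum_val_inj->//|/(_ j)]; rewrite eqxx.
Qed.

End Embedding.

(** The subgraph is not assumed induced, but isometry makes it so. *)
Lemma partial_cube_embedding (T : finType) (e : rel T) : partial_cube e ->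
  exists n (f : T -> cube n), [/\ injective f,
    forall x y, e x y = cube_edge (f x) (f y) &
    forall x y, x != y ->
      exists2 z, e z y & ham (f x) (f z) < ham (f x) (f y)].
Proof.
case=> _ [n [S [eH [[subH isoH] [f [f_inj imf f_edge]]]]]].
have hS x y z : eH y z -> ham x z <= (ham x y).+1.
  by case/subH => _ _; apply: ham_edge.
have fS x : f x \in S by rewrite -imf imset_f ?inE.
have step x y : x != y -> exists2 z, e z y & ham (f x) (f z) < ham (f x) (f y).
  move=> neq; have := isoH _ _ (fS x) (fS y); rewrite gdist_cube => dxy.
  have [|p] := dist_last (@hamxx n) hS _ dxy (ham_lt_card _ _).
    by apply: contra_neq neq => /f_inj.
  by rewrite -imf => /imsetP[z _ ->]; rewrite -f_edge => -[]; exists z.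
exists n, f; split=> // x y; apply/idP/idP; first by rewrite f_edge => /subH[].
move=> xy; have neq : x != y.
  by apply: contraTneq xy => ->; rewrite /cube_edge -[#|_|]/(ham _ _) hamxx.
(* At Hamming distance one, the closer neighbour [z] of [y] can only be [x]. *)
have [z ezy] := step x y neq; rewrite [X in _ < X](eqP xy) ltnS leqn0.
by move=> /eqP/ham_eq0/f_inj->.
Qed.

Theorem theorem1p2 (T : finType) (e : rel T) (k : nat) :
  simple_graph e -> almost_median e ->
  (regular e k <-> iso_to_cube e k).
Proof.
move=> _ [pc iso]; split=> [reg|[g [g_bij g_edge]] x].
  have [[[x0 _] _] _] := pc.
  have [n [f [f_inj f_edge step]]] := partial_cube_embedding pc.
  apply: (regular_iso_to_cube f_inj f_edge step x0) reg => i c.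
  by apply: emb_zone_geodetic => // u v /iso[].
(* The degree counts the directions at [g x]; as [g] is onto, all [k] occur. *)
rewrite (card_dirs (bij_inj g_bij) g_edge) -[RHS]card_ord -cardsT.
apply: eq_card => i; have [g' _ g'K] := g_bij.
by rewrite !inE -(g'K (flip i (g x))) imset_f ?inE.
Qed.
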